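(* Consider a statistical model that is invariant under a group $\mathscr{G}$, satisfying the model assumptions A1–A3 in the context, with $\mathbb{T}=\mathscr{G}=\overline{\mathscr{G}}=\widetilde{\mathscr{G}}$. Let $\mathsf{\Pi}_x$ be the (conditional) IM's upper probability, with contour $\pi_x$, and let $\mathsf{Q}_x^\star$ be the Bayes posterior distribution based on the right Haar prior; suppose $\mathsf{Q}_x^\star$ is the maximal element in the IM's credal set, i.e. $$\mathsf{Q}_x^\star(\{\theta:\pi_x(\theta)>\alpha\})=1-\alpha,\quad\alpha\in[0,1].$$ Let $\ell_a:\mathbb{T}\to[0,\infty)$, $a\in\mathbb{A}$, be an invariant loss function, and let $\hat a(x)=\arg\min_{a\in\mathbb{A}}\mathsf{Q}_x^\star\ell_a$ be the Bayes rule. Suppose that, for all $\theta,\theta'\in\mathbb{T}$, $$\pi_x(\theta)\le\pi_x(\theta')\implies\ell_{\hat a(x)}(\theta)\ge\ell_{\hat a(x)}(\theta').$$ Then $$\inf_{a\in\mathbb{A}}\mathsf{\Pi}_x\ell_a=\mathsf{\Pi}_x\ell_{\hat a(x)}=\mathsf{Q}_x^\star\ell_{\hat a(x)}.$$ That is, the Bayes rule $\hat a(x)$ also minimizes the IM's upper expected loss, and the two risk assessments at $\hat a(x)$ are equal.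
   Context: Invariant model: $\mathscr{G}$ is a group (under composition $\circ$) of bijections $g:\mathbb{X}\to\mathbb{X}$, and $\{p_\theta:\theta\in\mathbb{T}\}$ is a family of densities such that for each $g\in\mathscr{G}$, $\theta\in\mathbb{T}$ there is $\bar g\theta\in\mathbb{T}$ with $p_\theta(x)=p_{\bar g\theta}(gx)\,\chi(g)$ for all $x$, where $\chi(g)$ is a change-of-variables Jacobian term; equivalently $\mathsf{P}_\theta(gX\in\cdot)=\mathsf{P}_{\bar g\theta}(X\in\cdot)$. $\overline{\mathscr{G}}$ is the group of all maps $\bar g:\mathbb{T}\to\mathbb{T}$. One identifies $\mathbb{T}=\mathscr{G}=\overline{\mathscr{G}}$, so parameters are group elements and $\bar g\theta=g\circ\theta$. The group with respect to which the model is invariant is assumed unique. The orbit of $x$ is $\mathscr{G}x=\{gx:g\in\mathscr{G}\}$; $x$ is identified with $(g_x,u_x)$, where $u_x\in\mathbb{U}$ labels the orbit and $g_x\in\mathscr{G}$ is the position of $x$ on its orbit. Model assumptions: $\mathscr{G}$ is a locally compact topological group, and A1. the left Haar measure $\lambda$ and the corresponding right Haar measure $\rho$ on the Borel $\sigma$-algebra of $\mathscr{G}$ exist and are unique up to scalar multiples; A2. there is a bijection $t:\mathbb{X}\to\mathscr{G}\times\mathbb{U}$, with $t$ and $t^{-1}$ measurable, mapping $x$ to its position–orbit coordinates $(g_x,u_x)$ (so $t(gx)=(g\circ g_x,u_x)$); A3. the distribution of $t(X)=(G,U)$ induced by $X\sim\mathsf{P}_\theta$ has a density with respect to $\lambda\times\mu$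 for some measure $\mu$ on $\mathbb{U}$. The statistic $U$ is ancillary (its distribution under $\mathsf{P}_\theta$ does not depend on $\theta$). Conditional possibilistic inferential model (IM): with $R(x,\theta)=p_\theta(x)/\sup_\vartheta p_\vartheta(x)$ and $x\equiv(g,u)$, the contour is $$\pi_x(\theta)=\pi_{g|u}(\theta)=\mathsf{P}_\theta\{R(X,\theta)\le R(x,\theta)\mid U=u\},$$ and $\mathsf{\Pi}_x(H)=\sup_{\theta\in H}\pi_x(\theta)$. For $f:\mathbb{T}\to[0,\infty)$ the upper expectation is the Choquet integral $$\mathsf{\Pi}_xf=\int_0^1\Bigl\{\sup_{\theta:\pi_x(\theta)>s}f(\theta)\Bigr\}ds=\int_0^\infty\mathsf{\Pi}_x(\{\theta:f(\theta)>t\})\,dt,$$ assumed to exist for the losses considered. The credal set of $\mathsf{\Pi}_x$ is the set of countably additive probabilities $\mathsf{Q}$ on $\mathbb{T}$ with $\mathsf{Q}(\cdot)\le\mathsf{\Pi}_x(\cdot)$ on measurable sets. Bayes posterior: $\mathsf{Q}_x^\star(d\theta)\propto p_\theta(x)\,\rho(d\theta)$ (a probability measure on $\mathbb{T}$), and $\mathsf{Q}_x^\star f=\int f(\theta)\,\mathsf{Q}_x^\star(d\theta)$. Invariant loss: for every $\bar g\in\overline{\mathscr{G}}$ there exists $\tilde g:\mathbb{A}\to\mathbb{A}$ with $\ell_{\tilde ga}(\bar g\theta)=\ell_a(\theta)$ for all $(a,\theta)$; the collection $\widetilde{\mathscr{G}}$ of all such $\tilde g$ is a group under composition, identified with $\mathscr{G}$.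 *)

(* Defs.v *)
From HB Require Import structures.
From mathcomp Require Import all_boot all_order all_algebra.
From mathcomp Require Import all_classical all_reals all_analysis.

Set Implicit Arguments.
Unset Strict Implicit.
Unset Printing Implicit Defensive.

Import Order.TTheory GRing.Theory Num.Theory.
Import numFieldNormedType.Exports.

Local Open Scope classical_set_scope.
Local Open Scope ring_scope.

HB.mixin Record isTopologicalGroup G of PointedTopological G & Group G := {
  mulg_continuous : continuous (fun z : G * G => (z.1 * z.2)%g) ;
  invg_continuous : continuous (fun g : G => g^-1%g)
}.

#[short(type="topologicalGroupType")]
HB.structure Definition TopologicalGroup :=
  {G of PointedTopological G & Group G & isTopologicalGroup G}.

Notation borel G := (g_sigma_algebraType (@open G)).

Section haar.
Context {R : realType} {G : topologicalGroupType}.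
Implicit Types m : set (borel G) -> \bar R.

(* Compact sets are required to be Borel because [G] is not assumed to be
   Hausdorff. *)
Definition radon m :=
  [/\ (forall K : set G, compact K -> measurable (K : set (borel G)) ->
         (m K < +oo)%E),
      (forall A : set (borel G), measurable A ->
         m A = ereal_inf [set m V | V in [set V : set G | open V /\ A `<=` V]])
    & (forall V : set G, open V ->
         m V = ereal_sup [set m K | K in [set K : set G |
           [/\ compact K, measurable (K : set (borel G)) & K `<=` V]]])].

Definition left_haar m :=
  [/\ radon m, m setT != 0%E &
      forall (g : G) (A : set (borel G)), measurable A ->
        m [set (g * h)%g | h in A] = m A].

Definition right_haar m :=
  [/\ radon m, m setT != 0%E &
      forall (g : G) (A : set (borel G)), measurable A ->
        m [set (h * g)%g | h in A] = m A].

Definition unique_up_to_scaling (P : (set (borel G) -> \bar R) -> Prop) m :=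
  forall m' : {measure set (borel G) -> \bar R}, P m' ->
    exists2 c : R, 0 < c &
      forall A : set (borel G), measurable A -> m' A = (c%:E * m A)%E.

End haar.

(* A group of bijections of [S]: a faithful action of [G] on [S]. *)
Definition faithful_action {G : topologicalGroupType} {S : Type}
    (act : G -> S -> S) :=
  [/\ forall s, act 1%g s = s,
      forall g h s, act (g * h)%g s = act g (act h s)
    & injective act].

Section model.
Context {R : realType} {G : topologicalGroupType}.
Context {dX : measure_display} {X : measurableType dX}.
Context {dU : measure_display} {U : measurableType dU}.

Definition model_prob (nu : set X -> \bar R) (p : G -> X -> R) (theta : G)
    (B : set X) : \bar R :=
  (\int[nu]_(y in B) (p theta y)%:E)%E.

(* Joint measurability of the likelihood is what gives a meaning to the
   posterior density [theta |-> p theta x] for every prior. *)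
Definition density_family (nu : set X -> \bar R) (p : G -> X -> R) :=
  [/\ forall theta y, 0 <= p theta y,
      measurable_fun setT (fun z : borel G * X => p z.1 z.2)
    & forall theta, model_prob nu p theta setT = 1%E].

(* Parameters are group elements, and the induced action of [g] on parameters
   is left multiplication. The last clause says that [chi] is the Jacobian
   term of the change of variables [y |-> act g y]. *)
Definition invariant_model (nu : set X -> \bar R) (p : G -> X -> R)
    (act : G -> X -> X) (chi : G -> R) :=
  [/\ faithful_action act,
      forall g, 0 < chi g,
      forall g theta y, p theta y = p (g * theta)%g (act g y) * chi g
    & forall g theta (B : set X), measurable B ->
        model_prob nu p theta (act g @^-1` B) =
        model_prob nu p (g * theta)%g B].

(* [tinv] is the inverse of [t], which sends [y] to its position [(t y).1] and
   its orbit label [(t y).2]. *)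
Definition position_orbit (act : G -> X -> X)
    (t : X -> borel G * U) (tinv : borel G * U -> X) :=
  [/\ cancel t tinv, cancel tinv t,
      measurable_fun setT t, measurable_fun setT tinv
    & forall g y, t (act g y) = ((g * (t y).1)%g, (t y).2)].

(* [q theta] is a density of the law of [t X] under [theta] with respect to
   [lambda \x mu]; joint measurability is a choice of versions. *)
Definition position_orbit_density (nu : set X -> \bar R) (p : G -> X -> R)
    (t : X -> borel G * U)
    (lambda : {sigma_finite_measure set (borel G) -> \bar R})
    (mu : {sigma_finite_measure set U -> \bar R})
    (q : G -> borel G * U -> R) :=
  [/\ forall theta z, 0 <= q theta z,
      measurable_fun setT (fun w : borel G * (borel G * U) => q w.1 w.2)
    & forall theta (B : set (borel G * U)), measurable B ->
        model_prob nu p theta (t @^-1` B) =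
        (\int[lambda \x mu]_(z in B) (q theta z)%:E)%E].

(* If the likelihood is unbounded then [sup] is 0 and so is the quotient, in
   accordance with the convention [r / +oo = 0]. *)
Definition relative_likelihood (p : G -> X -> R) (y : X) (theta : G) : R :=
  p theta y / sup [set p vartheta y | vartheta in setT].

(* The conditional probability of [X \in E] given [U = u] under [theta], by
   means of the conditional density of the position given the orbit label. *)
Definition cond_prob (lambda : set (borel G) -> \bar R)
    (tinv : borel G * U -> X) (q : G -> borel G * U -> R)
    (theta : G) (u : U) (E : set X) : R :=
  fine (\int[lambda]_(g in [set g | E (tinv (g, u))]) (q theta (g, u))%:E)%E /
  fine (\int[lambda]_g (q theta (g, u))%:E)%E.

Definition contour (p : G -> X -> R) (lambda : set (borel G) -> \bar R)
    (t : X -> borel G * U) (tinv : borel G * U -> X)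
    (q : G -> borel G * U -> R) (x : X) (theta : G) : R :=
  cond_prob lambda tinv q theta (t x).2
    [set y | relative_likelihood p y theta <= relative_likelihood p x theta].

Definition bayes_posterior (p : G -> X -> R) (rho : set (borel G) -> \bar R)
    (x : X) (Q : probability (borel G) R) :=
  let Z := (\int[rho]_theta (p theta x)%:E)%E in
  (0 < Z < +oo)%E /\
  forall H : set (borel G), measurable H ->
    Q H = ((\int[rho]_(theta in H) (p theta x)%:E) * (fine Z)^-1%:E)%E.

End model.

Section imprecise.
Context {R : realType} {T : Type}.

(* [sup set0 = 0], so that the empty set has upper probability 0. *)
Definition upper_prob (pi : T -> R) (H : set T) : R :=
  sup [set pi theta | theta in H].

(* For [f >= 0]; this is also the integral over [s] in [0, 1] of the supremum
   of [f] on [set theta | s < pi theta] when [pi] has supremum 1. *)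
Definition choquet (pi : T -> R) (f : T -> R) : \bar R :=
  (\int[lebesgue_measure]_(s in `[0%R, +oo[)
     (upper_prob pi [set theta | s < f theta])%:E)%E.

End imprecise.

(* This forces [Q H <= upper_prob pi H] for every measurable [H], by taking
   [alpha := upper_prob pi H]. *)
Definition maximal_in_credal_set {R : realType} {G : topologicalGroupType}
    (pi : G -> R) (Q : set (borel G) -> \bar R) :=
  forall alpha : R, 0 <= alpha <= 1 ->
    Q [set theta | alpha < pi theta] = (1 - alpha)%:E.

(* All the maps [gtilde] that compensate some [g] form a group under
   composition, identified with [G] through [tact]. *)
Definition invariant_loss {R : realType} {G : topologicalGroupType} {A : Type}
    (l : A -> G -> R) :=
  exists tact : G -> A -> A,
    [/\ faithful_action tact,
        forall g a theta, l (tact g a) (g * theta)%g = l a theta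
      & [set tact g | g in setT] =
        [set gtilde : A -> A | exists g : G,
           forall a theta, l (gtilde a) (g * theta)%g = l a theta]].

Definition expected_loss {R : realType} {G : topologicalGroupType}
    (Q : set (borel G) -> \bar R) (f : G -> R) : \bar R :=
  (\int[Q]_theta (f theta)%:E)%E.

Definition bayes_action {R : realType} {G : topologicalGroupType} {A : Type}
    (Q : set (borel G) -> \bar R) (l : A -> G -> R) (a : A) :=
  forall b, (expected_loss Q (l a) <= expected_loss Q (l b))%E.

(* Main.v *)
Require Import Defs.
From HB Require Import structures.
From mathcomp Require Import all_boot all_order all_algebra.
From mathcomp Require Import all_classical all_reals all_analysis.
From mathcomp Require Import measurable_realfun ring.
Import Order.TTheory GRing.Theory Num.Theory.
Import numFieldNormedType.Exports.
Local Open Scope classical_set_scope.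
Local Open Scope ring_scope.

(** The contour [pi] is uniformly distributed on [0, 1] under the posterior [Q].
    Hence every measurable set [H], being contained in the lower level set of
    [pi] at its own upper probability, satisfies [Q H <= upper_prob pi H]
    ([prob_le_upper_prob]).  Writing both risks as integrals over [s >= 0] of
    the size of the level set [s < f], measured by [Q] in one case and by the
    upper probability in the other, gives [Q f <= choquet pi f] for every loss
    [f] ([expectation_le_choquet]).

    For the loss of the Bayes rule the inequality is an equality.  That loss is
    a decreasing function of [pi], so its upper level sets are lower sets of
    [pi]; a lower set of [pi] with upper probability [b] lies between [pi < b]
    and [pi <= b], both of [Q]-probability [b]
    ([choquet_eq_expectation]).  Therefore, for any action [a],
    [choquet pi (l ahat) = Q (l ahat) <= Q (l a) <= choquet pi (l a)],
    where the middle step is optimality of the Bayes rule.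

    These arguments apply [Q] to level sets of [pi], and additivity and
    monotonicity of [Q] are available on measurable sets only, so [pi] has to be
    measurable, and bounded by 1 ([contour_itv]).  Measurability is not
    immediate, since the relative likelihood involves a supremum over the
    group.  Invariance removes that supremum: moving along the orbit of the observation
    multiplies it by a Jacobian factor, itself a quotient of two
    density values ([sup_likelihood_act]).  The relative likelihood is then
    jointly measurable in the parameter and the position on the orbit, and
    Tonelli's theorem makes the contour measurable ([measurable_contour]). *)

(** * Tails of measurable functions *)

Section tails.
Context {R : realType} {d : measure_display} {T : measurableType d}.
Implicit Types (f : T -> R) (s : R).

Lemma setC_level_gt f s :
  ~` [set theta | s < f theta] = [set theta | f theta <= s].
Proof.
by apply/seteqP; split => th /=; [move/negP; rewrite -leNgt | rewrite leNgt => /negP].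
Qed.

Lemma measurable_level_gt f s : measurable_fun setT f ->
  measurable [set theta | s < f theta].
Proof.
move=> mf; rewrite [X in measurable X](_ : _ = f @^-1` `]s, +oo[%classic).
  by rewrite -[X in measurable X]setTI; exact: mf.
by apply/seteqP; split => th /=; rewrite in_itv/= andbT.
Qed.

Lemma measurable_level_le f s : measurable_fun setT f ->
  measurable [set theta | f theta <= s].
Proof.
by move=> mf; rewrite -setC_level_gt; exact/measurableC/measurable_level_gt.
Qed.

Variable Q : probability T R.

Lemma ccdf_level_gt f (mf : measurable_fun setT f) s :
  ccdf (P := Q) (mfun_Sub (mem_set mf : f \in mfun)) s =
  Q [set theta | s < f theta].
Proof.
rewrite /ccdf /distribution /pushforward; congr (Q _).
by apply/seteqP; split => th /=; rewrite in_itv/= andbT.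
Qed.

Lemma measurable_tail f (D : set R) : measurable D -> measurable_fun setT f ->
  measurable_fun D (fun s => Q [set theta | s < f theta]).
Proof.
move=> mD mf; apply: (measurable_funS measurableT) => //.
have := @ccdf_measurable _ _ _ Q (mfun_Sub (mem_set mf : f \in mfun)).
by apply: eq_measurable_fun => s _; exact: ccdf_level_gt.
Qed.

Lemma ge0_integral_tail f :
  measurable_fun setT f -> (forall theta, 0 <= f theta) ->
  (\int[Q]_theta (f theta)%:E =
   \int[lebesgue_measure]_(s in `[0%R, +oo[) Q [set theta | (s < f theta)%R])%E.
Proof.
move=> mf f0; pose F := mfun_Sub (mem_set mf : f \in mfun).
transitivity ('E_Q[F])%E; first by rewrite expectation_def.
by rewrite ge0_expectation_ccdf//; apply: eq_integral => s _; exact: ccdf_level_gt.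
Qed.

End tails.

(** * Choquet integrals against a contour with a uniform law *)

Section comonotone_risk.
Context {R : realType} {d : measure_display} {T : measurableType d}.
Variables (pi : T -> R).
Hypothesis pi01 : forall theta, 0 <= pi theta <= 1.

Lemma upper_prob_ub (H : set T) theta : H theta -> pi theta <= upper_prob pi H.
Proof.
move=> Hth; apply: ub_le_sup; last by exists theta.
by exists 1 => _ [th _ <-]; have /andP[] := pi01 th.
Qed.

Lemma upper_prob_lub (H : set T) (c : R) : 0 <= c ->
  (forall theta, H theta -> pi theta <= c) -> upper_prob pi H <= c.
Proof.
move=> c0 Hc; have [->|/set0P[th0 Hth0]] := eqVneq H set0.
  by rewrite /upper_prob image_set0 sup0.
by apply: ge_sup; [exists (pi th0), th0 | move=> _ [th Hth <-]; exact: Hc].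
Qed.

Lemma upper_prob_ge0 (H : set T) : 0 <= upper_prob pi H.
Proof.
have [->|/set0P[th0 Hth0]] := eqVneq H set0.
  by rewrite /upper_prob image_set0 sup0.
apply: (@le_trans _ _ (pi th0)); last exact: upper_prob_ub.
by have /andP[] := pi01 th0.
Qed.

Lemma upper_prob_itv (H : set T) : 0 <= upper_prob pi H <= 1.
Proof.
rewrite upper_prob_ge0 upper_prob_lub// => th _.
by have /andP[] := pi01 th.
Qed.

Lemma upper_prob_sub (H K : set T) : H `<=` K ->
  upper_prob pi H <= upper_prob pi K.
Proof.
move=> HK; apply: upper_prob_lub => [|th /HK]; first exact: upper_prob_ge0.
exact: upper_prob_ub.
Qed.

(** Monotonicity in [s] is the source of measurability. *)
Lemma measurable_upper_tail (f : T -> R) (D : set R) : measurable D ->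
  measurable_fun D (fun s => (upper_prob pi [set theta | s < f theta])%:E).
Proof.
move=> mD; apply/measurable_EFinP; apply: nonincreasing_measurable => //.
by move=> s t st; apply: upper_prob_sub => th /=; exact: le_lt_trans.
Qed.

Variable Q : probability T R.
Hypothesis mpi : measurable_fun setT pi.
Hypothesis Qpi : forall alpha : R, 0 <= alpha <= 1 ->
  Q [set theta | alpha < pi theta] = (1 - alpha)%:E.

Lemma prob_level_le (alpha : R) : 0 <= alpha <= 1 ->
  Q [set theta | pi theta <= alpha] = alpha%:E.
Proof.
move=> a01; rewrite -setC_level_gt probability_setC; last exact: measurable_level_gt.
by rewrite Qpi// -EFinB opprB addrC subrK.
Qed.

(** This is membership of [Q] in the credal set: [H] lies inside the lower level
    set of [pi] at height [upper_prob pi H], whose probability is that height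
    because [pi] is uniformly distributed under [Q]. *)
Lemma prob_le_upper_prob (H : set T) : measurable H ->
  (Q H <= (upper_prob pi H)%:E)%E.
Proof.
move=> mH; rewrite -prob_level_le; last exact: upper_prob_itv.
apply: le_measure; rewrite ?inE//; first exact: measurable_level_le.
by move=> th Hth; exact: upper_prob_ub.
Qed.

(** Integrating [Q <= upper_prob pi] over the upper level sets of [f]. *)
Lemma expectation_le_choquet (f : T -> R) :
  measurable_fun setT f -> (forall theta, 0 <= f theta) ->
  (\int[Q]_theta (f theta)%:E <= choquet pi f)%E.
Proof.
move=> mf f0; rewrite ge0_integral_tail//.
apply: ge0_le_integral => //.
- exact: measurable_tail.
- exact: measurable_upper_tail.
- by move=> s _; apply/prob_le_upper_prob/measurable_level_gt.
Qed.

(** A set closed under decreasing [pi] contains every strictly lower level set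
    below [b := upper_prob pi H], so its probability is at least [b - e] for
    each [e > 0]: on such sets [Q] attains the upper probability. *)
Lemma prob_ge_upper_prob (H : set T) : measurable H ->
  (forall theta theta', pi theta <= pi theta' -> H theta' -> H theta) ->
  ((upper_prob pi H)%:E <= Q H)%E.
Proof.
move=> mH Hdown; apply/lee_addgt0Pr => e e0.
have /andP[b0 b1] := upper_prob_itv H; set b := upper_prob pi H in b0 b1 *.
(* [b - e] must be a level in [0, 1] for its lower level set to have a known
   probability. *)
have [be|eb] := leP b e.
  by apply: (@le_trans _ _ e%:E); rewrite ?lee_fin// leeDr.
rewrite -leeBlDr// -EFinB -prob_level_le; last first.
  by rewrite subr_ge0 (ltW eb)/= lerBlDr (le_trans b1)// lerDl ltW.
apply: le_measure; rewrite ?inE//; first exact: measurable_level_le.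
move=> th /= thb; apply: contrapT => nH.
have : b <= b - e.
  apply: upper_prob_lub => [|th' Hth']; first by rewrite subr_ge0 ltW.
  rewrite leNgt; apply/negP => lt; apply: nH; apply: Hdown Hth'.
  exact: le_trans thb (ltW lt).
by rewrite lerBrDl gerDr leNgt e0.
Qed.

(** When [f] decreases with [pi], the level sets [s < f] are closed under
    decreasing [pi], so the two integrands over [s] coincide. *)
Lemma choquet_eq_expectation (f : T -> R) :
  measurable_fun setT f -> (forall theta, 0 <= f theta) ->
  (forall theta theta', pi theta <= pi theta' -> f theta' <= f theta) ->
  choquet pi f = (\int[Q]_theta (f theta)%:E)%E.
Proof.
move=> mf f0 fpi; rewrite ge0_integral_tail//.
apply: eq_integral => s _; apply/eqP; rewrite eq_le.
rewrite prob_le_upper_prob ?andbT; last exact: measurable_level_gt.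
apply: prob_ge_upper_prob => [|th th' /fpi le /=]; first exact: measurable_level_gt.
by move/lt_le_trans; exact.
Qed.

End comonotone_risk.

(** * Auxiliary facts on suprema and measurability *)

(** Unbounded [E] are included, since both sides are then 0. *)
Lemma sup_scale (R : realType) (c : R) (E : set R) : 0 < c ->
  sup [set c * r | r in E] = c * sup E.
Proof.
move=> c0.
have [supE|nsupE] := pselect (has_sup E); last first.
  rewrite !sup_out ?mulr0// => -[[_ [r Er _]] [M HM]]; apply: nsupE; split.
    by exists r.
  exists (c^-1 * M) => s Es; rewrite ler_pdivlMl//.
  by apply: HM; exists s.
have [[r0 Er0] ubE] := supE.
apply/eqP; rewrite eq_le; apply/andP; split.
  apply: ge_sup; first by exists (c * r0), r0.
  by move=> _ [r Er <-]; rewrite ler_pM2l//; exact: ub_le_sup.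
rewrite -ler_pdivlMl//; apply: ge_sup; first by exists r0.
move=> r Er; rewrite ler_pdivlMl//; apply: ub_le_sup; last by exists r.
by exists (c * sup E) => _ [s Es <-]; rewrite ler_pM2l//; exact: ub_le_sup.
Qed.

Lemma measurable_fun_inv {R : realType} {d : measure_display} {T : measurableType d}
    (f : T -> R) :
  (forall z, 0 <= f z) -> measurable_fun setT f ->
  measurable_fun setT (fun z => (f z)^-1).
Proof.
move=> f0 mf; under eq_fun do rewrite -powR_inv1//.
exact: (measurableT_comp (measurable_powR _) mf).
Qed.

Lemma measurable_right_translation (G : topologicalGroupType) (c : G) :
  measurable_fun [set: borel G] ((fun g => g * c)%g : borel G -> borel G).
Proof.
apply: (@measurability _ _ (borel G) (borel G) setT _ (@open G)) => //.
move=> _ [V oV <-]; rewrite setTI.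
apply: sub_sigma_algebra; apply: open_comp oV => g _.
apply: (@continuous_comp _ _ _ (fun g : G => (g, c)) (fun z : G * G => z.1 * z.2)%g).
  by apply: cvg_pair; [exact: cvg_id | exact: cvg_cst].
exact: mulg_continuous.
Qed.

(** Tonelli's measurability of partial integrals, when the domain of integration
    varies with the parameter. *)
Lemma measurable_fubini_section {R : realType} {d1 d2 : measure_display}
    {T1 : measurableType d1} {T2 : measurableType d2}
    (m : {sigma_finite_measure set T2 -> \bar R}) (f : T1 * T2 -> R)
    (D : set (T1 * T2)) :
  measurable D -> measurable_fun setT f -> (forall z, 0 <= f z) ->
  measurable_fun setT
    (fun z1 => (\int[m]_(z2 in [set z2 | D (z1, z2)]) (f (z1, z2))%:E)%E).
Proof.
move=> mD mf f0.
have mF : measurable_fun setT ((fun z => (f z)%:E) \_ D).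
  by apply: (measurable_restrictT _ mD).1; apply/measurable_funTS/measurable_EFinP.
have := @measurable_fun_fubini_tonelli_F _ _ _ _ _ m _ mF.
have F0 z : (0 <= ((fun z => (f z)%:E) \_ D) z)%E.
  by apply: erestrict_ge0 => w _; rewrite lee_fin.
move/(_ F0); apply: eq_measurable_fun => z1 _.
rewrite /fubini_F [RHS]integral_mkcond; apply: eq_integral => z2 _.
rewrite !patchE.
suff -> : (z2 \in [set z2 | D (z1, z2)]) = ((z1, z2) \in D) by [].
by apply/idP/idP; rewrite !inE.
Qed.

(** * The contour of an invariant model is measurable *)

Section contour_measurability.
Context {R : realType} {G : topologicalGroupType}.
Context {dX : measure_display} {X : measurableType dX}.
Context {dU : measure_display} {U : measurableType dU}.
Variables (nu : {measure set X -> \bar R}) (p : G -> X -> R).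
Variables (act : G -> X -> X) (chi : G -> R).
Variables (t : X -> borel G * U) (tinv : borel G * U -> X).
Variables (lambda : {sigma_finite_measure set (borel G) -> \bar R}).
Variables (mu : {sigma_finite_measure set U -> \bar R}).
Variables (q : G -> borel G * U -> R) (x : X).
Hypothesis hp : density_family nu p.
Hypothesis hinv : invariant_model nu p act chi.
Hypothesis ht : position_orbit act t tinv.
Hypothesis hq : position_orbit_density nu p t lambda mu q.

Let sup_likelihood (y : X) : R := sup [set p vartheta y | vartheta in setT].

(** The change of variables by [h] multiplies all likelihoods by the same
    Jacobian factor, and that factor can be read off any single parameter with
    a nonzero likelihood; the supremum over all parameters is thus expressed by
    one density value, which is measurable in [h]. *)
Lemma sup_likelihood_act (h theta0 : G) (y : X) : p theta0 y != 0 ->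
  sup_likelihood (act h y) =
  sup_likelihood y / p theta0 y * p (h * theta0)%g (act h y).
Proof.
move=> p0; have [_ chi0 pchi _] := hinv.
have -> : sup_likelihood y = chi h * sup_likelihood (act h y).
  rewrite -sup_scale//; congr sup; apply/seteqP; split => [_ [th _ <-]|].
    exists (p (h * th)%g (act h y)); first by exists (h * th)%g.
    by rewrite mulrC -pchi.
  move=> _ [_ [th _ <-] <-]; exists (h^-1 * th)%g => //.
  by rewrite (pchi h) mulgA mulgV mul1g mulrC.
move: p0; rewrite (pchi h theta0 y) mulf_eq0 negb_or => /andP[p'0 c0].
by field; rewrite c0 p'0.
Qed.

(** The normalizing constant of the posterior is positive. *)
Lemma posterior_likelihood_neq0 (rho : {measure set (borel G) -> \bar R})
    (Q : probability (borel G) R) :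
  bayes_posterior p rho x Q -> exists theta0, p theta0 x != 0.
Proof.
move=> [/andP[Z0 _] _]; apply: contrapT => /forallNP p0.
move: Z0; rewrite integral0_eq ?ltxx// => theta _.
by have /negP := p0 theta; rewrite negbK => /eqP ->.
Qed.

Let u : U := (t x).2.

Lemma orbit_pointE (g : G) : tinv (g, u) = act (g * (t x).1^-1)%g x.
Proof.
have [tK tinvK _ _ tact] := ht.
apply: (can_inj tK); rewrite tinvK tact; congr pair.
by rewrite -mulgA mulVg mulg1.
Qed.

(** On the orbit of [x] the only remaining supremum is a constant; the rest is
    built from the density and a right translation of [g], so that joint
    measurability in [(theta, g)] becomes visible. *)
Lemma relative_likelihood_orbitE (theta0 : G) (g theta : G) : p theta0 x != 0 ->
  relative_likelihood p (tinv (g, u)) theta =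
  p theta (tinv (g, u)) *
  (sup_likelihood x / p theta0 x *
   p (g * ((t x).1^-1 * theta0))%g (tinv (g, u)))^-1.
Proof.
move=> p0; rewrite /relative_likelihood; congr (_ * _^-1).
by rewrite mulgA orbit_pointE; exact: sup_likelihood_act.
Qed.

Let less_plausible : set (borel G * borel G) :=
  [set z | relative_likelihood p (tinv (z.2, u)) z.1 <=
           relative_likelihood p x z.1].

Hypothesis px : exists theta0, p theta0 x != 0.

Lemma sup_likelihood_ge0 y : 0 <= sup_likelihood y.
Proof.
have [p0 _ _] := hp.
rewrite /sup_likelihood; have [[_ ub]|ns] := pselect (has_sup [set p v y | v in setT]).
  apply: (@le_trans _ _ (p 1%g y)); first exact: p0.
  by apply: ub_le_sup => //; exists 1%g.
by rewrite sup_out.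
Qed.

Lemma measurable_likelihood {d : measure_display} {T : measurableType d}
    (f : T -> borel G) (y : T -> X) :
  measurable_fun setT f -> measurable_fun setT y ->
  measurable_fun setT (fun z => p (f z) (y z)).
Proof.
have [_ mp _] := hp => mf my.
exact: (measurableT_comp mp (measurable_fun_pair mf my)).
Qed.

Lemma measurable_less_plausible : measurable less_plausible.
Proof.
have [theta0 p0] := px; have [pge0 _ _] := hp; have [_ _ _ mtinv _] := ht.
have morb : measurable_fun setT (fun z : borel G * borel G => tinv (z.2, u)).
  apply: (measurableT_comp mtinv).
  exact: (measurable_fun_pair measurable_snd (measurable_cst _)).
rewrite -[X in measurable X]setTI.
pose r1 (z : borel G * borel G) := relative_likelihood p (tinv (z.2, u)) z.1.
pose r2 (z : borel G * borel G) := relative_likelihood p x z.1.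
have mr1 : measurable_fun setT r1.
  rewrite /r1; under eq_fun do rewrite (relative_likelihood_orbitE theta0)//.
  apply: measurable_funM; first exact: measurable_likelihood.
  apply: measurable_fun_inv.
    by move=> z; rewrite mulr_ge0// divr_ge0// sup_likelihood_ge0.
  apply: measurable_funM => //; apply: measurable_likelihood => //.
  exact: (measurableT_comp (measurable_right_translation _ _) measurable_snd).
have mr2 : measurable_fun setT r2.
  by apply: measurable_funM => //; exact: measurable_likelihood.
have := measurable_fun_ler mr1 mr2 measurableT.
by move=> /(_ [set true]); exact.
Qed.

Lemma measurable_section_event (theta : G) :
  measurable [set g : borel G | less_plausible (theta, g)].
Proof.
have := @measurable_xsection _ _ (borel G) (borel G) _ theta measurable_less_plausible.
by rewrite xsectionE.
Qed.

Let q_slice (z : borel G * borel G) : R := q z.1 (z.2, u).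

Lemma measurable_q_slice : measurable_fun setT q_slice.
Proof.
have [_ mq _] := hq.
have minsert : measurable_fun setT
    (fun z : borel G * borel G => (z.1, (z.2, u)) : borel G * (borel G * U)).
  apply: (measurable_fun_pair measurable_fst).
  exact: (measurable_fun_pair measurable_snd (measurable_cst _)).
exact: (measurableT_comp mq minsert).
Qed.

(** The contour is a quotient of two integrals over [g] of jointly measurable
    functions of [(theta, g)], on a jointly measurable domain. *)
Lemma measurable_contour :
  measurable_fun [set: borel G] (contour p lambda t tinv q x).
Proof.
have [q0 _ _] := hq.
have mnum := measurable_fubini_section lambda q_slice less_plausible
  measurable_less_plausible measurable_q_slice (fun z => q0 _ _).
have mden := measurable_fubini_section lambda q_slice setT
  measurableT measurable_q_slice (fun z => q0 _ _).
apply: measurable_funM.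
  by apply: (measurableT_comp _ mnum).
apply: measurable_fun_inv.
  by move=> theta; apply/fine_ge0/integral_ge0 => g _; rewrite lee_fin.
exact: (measurableT_comp _ mden).
Qed.

(** If the conditional density has an infinite integral, then the normalizing
    constant is 0 by the convention on [fine], and so is the contour. *)
Lemma contour_itv (theta : G) : 0 <= contour p lambda t tinv q x theta <= 1.
Proof.
have [q0 _ _] := hq; rewrite /contour /cond_prob.
set num := fine _; set den := fine _.
have num0 : 0 <= num by apply/fine_ge0/integral_ge0 => g _; rewrite lee_fin.
have den0 : 0 <= den by apply/fine_ge0/integral_ge0 => g _; rewrite lee_fin.
rewrite divr_ge0//=.
have [->|dn0] := eqVneq den 0; first by rewrite invr0 mulr0.
rewrite ler_pdivrMr ?lt_def ?dn0// mul1r.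
have mqs : measurable_fun [set: borel G] (fun g => (q theta (g, u))%:E).
  have mpair : measurable_fun setT (fun g : borel G => (theta : borel G, g)).
    exact: pair1_measurable.
  by apply/measurable_EFinP; exact: (measurableT_comp measurable_q_slice mpair).
have le : (\int[lambda]_(g in [set g | less_plausible (theta, g)])
             (q theta (g, u))%:E <= \int[lambda]_g (q theta (g, u))%:E)%E.
  apply: ge0_subset_integral => //; first exact: measurable_section_event.
  by move=> g _; rewrite lee_fin.
have denfin : (\int[lambda]_g (q theta (g, u))%:E)%E \is a fin_num.
  by apply: contraNT dn0; rewrite /den; case: (\int[_]_(_ in _) _)%E.
apply: fine_le => //; rewrite ge0_fin_numE; last first.
  by apply: integral_ge0 => g _; rewrite lee_fin.
by apply: le_lt_trans le _; rewrite ltey_eq denfin.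
Qed.

End contour_measurability.

(** * The Bayes rule minimizes the upper expected loss *)

Theorem theorem4 (R : realType) (G : topologicalGroupType)
    (dX : measure_display) (X : measurableType dX)
    (dU : measure_display) (U : measurableType dU)
    (nu : {measure set X -> \bar R}) (p : G -> X -> R)
    (act : G -> X -> X) (chi : G -> R)
    (lambda : {sigma_finite_measure set (borel G) -> \bar R})
    (rho : {measure set (borel G) -> \bar R})
    (t : X -> borel G * U) (tinv : borel G * U -> X)
    (mu : {sigma_finite_measure set U -> \bar R})
    (q : G -> borel G * U -> R)
    (x : X) (Q : probability (borel G) R)
    (A : Type) (l : A -> G -> R) (ahat : X -> A)
    (hG : locally_compact [set: G])
    (hp : density_family nu p)
    (hinv : invariant_model nu p act chi)
    (hlambda : left_haar lambda)
    (hlambda_unique : unique_up_to_scaling left_haar lambda)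
    (hrho : right_haar rho)
    (hrho_unique : unique_up_to_scaling right_haar rho)
    (ht : position_orbit act t tinv)
    (hq : position_orbit_density nu p t lambda mu q)
    (hQ : bayes_posterior p rho x Q)
    (hQmax : maximal_in_credal_set (contour p lambda t tinv q x) Q)
    (hl0 : forall a theta, 0 <= l a theta)
    (hlmeas : forall a, measurable_fun [set: borel G] (l a))
    (hlinv : invariant_loss l)
    (hahat : bayes_action Q l (ahat x))
    (hmono : forall theta theta' : G,
      contour p lambda t tinv q x theta <= contour p lambda t tinv q x theta' ->
      l (ahat x) theta' <= l (ahat x) theta) :
  ereal_inf [set choquet (contour p lambda t tinv q x) (l a) | a in [set: A]] =
    choquet (contour p lambda t tinv q x) (l (ahat x)) /\
  choquet (contour p lambda t tinv q x) (l (ahat x)) =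
    expected_loss Q (l (ahat x)).
Proof.
have px := posterior_likelihood_neq0 p x rho Q hQ.
have mpi := measurable_contour nu p act chi t tinv lambda mu q x hp hinv ht hq px.
have pi01 := contour_itv nu p act chi t tinv lambda mu q x hp hinv ht hq px.
have risk_ahat := @choquet_eq_expectation R _ (borel G) _ pi01 Q mpi hQmax _
  (hlmeas (ahat x)) (hl0 (ahat x)) hmono.
split; last exact: risk_ahat.
apply/eqP; rewrite eq_le; apply/andP; split.
  by apply: ereal_inf_lbound; exists (ahat x).
apply: le_ereal_inf_tmp => _ [a _ <-].
rewrite risk_ahat; apply: le_trans (hahat a) _.
exact: (@expectation_le_choquet R _ (borel G) _ pi01 Q mpi hQmax _ (hlmeas a) (hl0 a)).
Qed.
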